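(* If $C \subseteq \mathbb{Z}^2$ is a $2$-identifying code in the square grid $G_S$, then its density satisfies $D(C) \geq \frac{6}{35}$.
   Context: The square grid is the infinite graph $G_S = (V_S, E_S)$ with $V_S = \mathbb{Z}^2$ and $E_S = \{ \{\mathbf{u},\mathbf{v}\} \mid \mathbf{u},\mathbf{v} \in \mathbb{Z}^2,\ \mathbf{u}-\mathbf{v} \in \{(0,\pm 1),(\pm 1,0)\}\}$. The distance $d(\mathbf{u},\mathbf{v})$ is the number of edges in a shortest path between $\mathbf{u}$ and $\mathbf{v}$, and $B_r(\mathbf{u}) = \{\mathbf{x} \in V_S \mid d(\mathbf{u},\mathbf{x}) \leq r\}$. A code is a nonempty subset $C \subseteq V_S$. For a code $C$ and a vertex $\mathbf{u}$, let $I_r(C;\mathbf{u}) = B_r(\mathbf{u}) \cap C$. A code $C$ is $r$-identifying in $G_S$ if $I_r(C;\mathbf{u})$ is nonempty for every $\mathbf{u} \in V_S$ and $I_r(C;\mathbf{u}) \neq I_r(C;\mathbf{v})$ for all $\mathbf{u},\mathbf{v} \in V_S$ with $\mathbf{u} \neq \mathbf{v}$. With $Q_n = \{(x,y) \in \mathbb{Z}^2 \mid |x| \leq n,\ |y| \leq n\}$, the density of a code $C$ is $$D(C) = \limsup_{n \to \infty} \frac{|C \cap Q_n|}{|Q_n|}.$$ *)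

(* Defs.v *)
From mathcomp Require Import all_boot all_order all_algebra finmap.
From mathcomp Require Import all_classical all_reals all_analysis.
Set Implicit Arguments.
Unset Strict Implicit.
Unset Printing Implicit Defensive.
Import Order.TTheory GRing.Theory Num.Theory.
Local Open Scope classical_set_scope.
Local Open Scope ring_scope.

Definition vertex := (int * int)%type.

Definition grid_edge : rel vertex :=
  fun u v => u - v \in [:: (0, 1); (0, -1); (1, 0); (-1, 0)].

(* A walk u = x_0, x_1, ..., x_k = v is given by u and the sequence p of its
   later vertices, so its number of edges is [size p]. *)
Definition has_walk (u v : vertex) (k : nat) : Prop :=
  exists p : seq vertex, [/\ path grid_edge u p, last u p = v & size p = k].

Lemma has_walk_trans u v w k l :
  has_walk u v k -> has_walk v w l -> has_walk u w (k + l).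
Proof.
move=> [p [pP <- <-]] [q [qP <- <-]]; exists (p ++ q).
by rewrite cat_path pP qP last_cat size_cat.
Qed.

Lemma has_walk_line (e u : vertex) (n : nat) :
  - e \in [:: (0, 1); (0, -1); (1, 0); (-1, 0)] -> has_walk u (u + e *+ n) n.
Proof.
move=> eP; elim: n => [|n IHn]; first by exists [::]; rewrite mulr0n addr0.
rewrite -addn1; apply: has_walk_trans IHn _.
exists [:: u + e *+ (n + 1)]; split=> //=.
rewrite andbT /grid_edge mulrnDr mulr1n (addrA u) opprD addrA subrr add0r.
exact: eP.
Qed.

Lemma has_walk_ex (u v : vertex) : exists k, `[< has_walk u v k >].
Proof.
have line (e : vertex) w (m : int) :
    e \in [:: (0, 1); (1, 0)] -> exists k, has_walk w (w + e *~ m) k.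
  move=> eP; case: m => n; [exists n|exists n.+1].
    apply: has_walk_line.
    by move: eP; rewrite !inE => /orP[] /eqP ->.
  rewrite NegzE mulrNz -mulNrz.
  apply: has_walk_line.
  by move: eP; rewrite !inE => /orP[] /eqP ->.
have [k hk] := line (1, 0) u (v.1 - u.1) isT.
have [l hl] := line (0, 1) (u + (1, 0) *~ (v.1 - u.1)) (v.2 - u.2) isT.
exists (k + l)%N; apply/asboolP; move: (has_walk_trans hk hl).
suff -> : u + (1, 0) *~ (v.1 - u.1) + (0, 1) *~ (v.2 - u.2) = v by [].
have pmz (a b : int) (m : int) : (a, b) *~ m = (a *~ m, b *~ m) :> vertex.
  case: m => n; rewrite ?NegzE ?mulrNz -?pmulrn.
    by elim: n => [|n IHn]; rewrite ?mulr0n // !mulrS IHn.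
  suff -> : (a, b) *+ n.+1 = (a *+ n.+1, b *+ n.+1) :> vertex by [].
  by elim: (n.+1) => [|m IHm]; rewrite ?mulr0n // !mulrS IHm.
rewrite !pmz !mul0rz !intz; case: u v {line hk hl} => [a b] [c d] /=.
by congr (_, _); rewrite /= ?addr0 addrC subrK.
Qed.

Definition gdist (u v : vertex) : nat := ex_minn (has_walk_ex u v).

Definition gball (r : nat) (u : vertex) : set vertex :=
  [set x | (gdist u x <= r)%N].

Definition code (C : set vertex) : Prop := C !=set0.

Definition Iset (r : nat) (C : set vertex) (u : vertex) : set vertex :=
  gball r u `&` C.

Definition identifying (r : nat) (C : set vertex) : Prop :=
  [/\ code C,
      forall u, Iset r C u !=set0 &
      forall u v, u <> v -> Iset r C u <> Iset r C v].

Definition box (n : nat) : set vertex :=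
  [set u : vertex | `|u.1| <= n%:Z /\ `|u.2| <= n%:Z].

(* [fset_set] returns the empty set on infinite sets. *)
Lemma finite_box n : finite_set (box n).
Proof.
apply: (@sub_finite_set _ _
  ([set (i%:Z - n%:Z, j%:Z - n%:Z) | i in `I_(n.*2.+1) & j in `I_(n.*2.+1)])).
  have H (x : int) : `|x| <= n%:Z ->
      exists2 i : nat, (i < n.*2.+1)%N & i%:Z - n%:Z = x.
    rewrite ler_norml => /andP[h1 h2].
    have h0 : 0 <= x + n%:Z by rewrite -(addNr n%:Z) lerD2r.
    exists (absz (x + n%:Z)); last by rewrite gez0_abs // addrK.
    by rewrite ltnS -lez_nat gez0_abs // -addnn PoszD lerD2r.
  move=> [x y] [/= /H[i hi <-] /H[j hj <-]].
  by exists i => //; exists j.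
by apply: finite_image2; exact: finite_II.
Qed.

(* The upper limit is taken in the extended reals, where it always exists. *)
Definition density (R : realType) (C : set vertex) : \bar R :=
  limn_esup (fun n : nat =>
    ((#|` fset_set (C `&` box n)|)%:R / (#|` fset_set (box n)|)%:R : R)%:E).

(* Main.v *)
Require Import Defs.
From HB Require Import structures.
From Stdlib Require Import ZArith FMapPositive.
From mathcomp Require Import all_boot all_order all_algebra finmap.
From mathcomp Require Import ssrZ zify lra.
From mathcomp Require Import all_classical all_reals all_analysis.
Set Implicit Arguments.
Unset Strict Implicit.
Unset Printing Implicit Defensive.
Import Order.TTheory GRing.Theory Num.Theory.
Local Open Scope classical_set_scope.
Local Open Scope ring_scope.
Local Delimit Scope Z_scope with coqZ.

(* Let I(u) be the set of codewords within distance 2 of u, and give a codeword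
   c the charge 18 + sum of psi |I(u)| over the 13 vertices u of its ball, where
   psi k = -8, -2, 0, 1 for k = 1, 2, 3, >= 4.  As k * psi k <= 4 k - 12, the
   total charge is at most 70 |C| - 12 |V|, so it suffices that the total charge
   is nonnegative: then the density is at least 12/70.  Single charges can be
   negative.  A codeword x of positive charge therefore divides it evenly among
   the codewords c with I(u) = {x, c} for some u, and in an identifying code a
   codeword of negative charge always receives enough this way.  That is a
   finite statement about a neighbourhood of c, decided by branching on the
   cells around c and then around its partners, up to the symmetries of the
   square.  On finite boxes all exchanges balance up to a term proportional to
   the perimeter. *)

(** * Balls, charges and gifts *)

Definition cell := (Z * Z)%type.

Definition cell_norm (p : cell) : Z := (Z.abs p.1 + Z.abs p.2)%coqZ.

(** Ordered by norm: the first entry is the origin, which [behead] drops, and the first 13 form the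
    ball of radius 2. The ball of a vertex of [disk2] stays inside [disk4]. *)
Definition disk4 : seq cell :=
  let r := [:: -4; -3; -2; -1; 0; 1; 2; 3; 4]%coqZ in
  flatten [seq [seq p <- [seq (x, y) | x <- r, y <- r] | Z.eqb (cell_norm p) k]
          | k <- [:: 0; 1; 2; 3; 4]%coqZ].

Definition disk2 : seq cell := take 13 disk4.

Definition ball2 (u : cell) : seq cell := [seq u + d | d <- disk2].

Definition card (f : pred cell) (u : cell) : nat := count f (ball2 u).

(** For k = 1, 2, 3, 4 this is the largest value with k * psi k <= 4 k - 12; from 4 on the default 1
    applies. *)
Definition psi (n : nat) : Z := nth 1%coqZ [:: -8; -8; -2; 0]%coqZ n.

Definition charge (f : pred cell) (x : cell) : Z :=
  18%coqZ + \sum_(d <- disk2) psi (card f (x + d)).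

Definition deg (f : pred cell) (x : cell) : nat :=
  count (fun d => card f (x + d) == 2) disk2.

(* Gifts are counted in units of 1/840 of charge, and d * rate d <= 840 for all
   possible degrees d <= 13. *)
Definition rate (d : nat) : Z :=
  nth 60%coqZ [:: 840; 840; 420; 280; 210; 168; 140; 120; 105]%coqZ d.

Definition gift (f : pred cell) (x : cell) : Z :=
  if charge f x <= 0 then 0 else charge f x * rate (deg f x).

(** If [x] is a codeword, each inner sum has exactly one term, the gift of the other codeword of I(x
    + d); [d + e != 0] excludes [x] itself. *)
Definition income (f : pred cell) (x : cell) : Z :=
  \sum_(d <- disk2 | card f (x + d) == 2)
    \sum_(e <- disk2 | f (x + d + e) && (d + e != 0)) gift f (x + d + e).

(** The local part of the identifying property: [x] lies in both balls compared, so the separating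
    codeword is never [x]. *)
Definition separated (f : pred cell) (x : cell) : Prop :=
  forall d e, d \in disk2 -> e \in disk2 -> d != e ->
  exists2 z, f z & (z \in ball2 (x + d)) != (z \in ball2 (x + e)).

Lemma psi_le m n : (0 < m)%N -> (m <= n)%N -> psi m <= psi n.
Proof.
rewrite /psi; case: m => [|[|[|[|m]]]] //; case: n => [|[|[|[|n]]]] //= _ _;
by rewrite ?nth_nil.
Qed.

Lemma rate_le m n : (m <= n)%N -> rate n <= rate m.
Proof.
elim: n m => [|n IHn] m; first by rewrite leqn0 => /eqP ->.
rewrite leq_eqVlt => /predU1P[-> //|]; rewrite ltnS => /IHn; apply: le_trans.
by rewrite /rate; clear IHn; do 9![case: n => [|n] //]; rewrite /= !nth_nil.
Qed.

Lemma rate_gt0 d : 0 < rate d.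
Proof. by rewrite /rate; do 9![case: d => [|d] //]; rewrite /= nth_nil. Qed.

Lemma gift_ge0 f x : 0 <= gift f x.
Proof.
rewrite /gift; case: ifP => // /negbT; rewrite -ltNge => h.
by rewrite mulr_ge0 ?ltW ?rate_gt0.
Qed.

(** * Computable bounds and the search *)

(* What is known about a vertex u near a focus x: the codewords of I(u) found so
   far, except x itself, and the undecided cells of the ball of u.  Cells are
   numbered by their position in [disk4], relative to x. *)
Definition entry := (seq positive * seq positive)%type.

Fixpoint same (a b : seq positive) : bool :=
  match a, b with
  | [::], [::] => true
  | x :: a', y :: b' => if Pos.eqb x y then same a' b' else false
  | _, _ => false
  end.

Fixpoint extract (i : positive) (s : seq positive) : option (seq positive) :=
  if s is j :: s' then
    if Pos.eqb i j then Some s'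
    else if extract i s' is Some r then Some (j :: r) else None
  else None.

Fixpoint decide (i : positive) (b : bool) (l : seq entry) : seq entry :=
  if l is (K, U) :: l' then
    (if extract i U is Some U' then (if b then i :: K else K, U') else (K, U))
      :: decide i b l'
  else [::].

Fixpoint has_key (K : seq positive) (l : seq entry) : bool :=
  if l is (K', _) :: l' then if same K K' then true else has_key K l' else false.

(* Two vertices with the same known codewords [K] cannot both satisfy
   I(u) = x :: K, so all but one of them count as having one more. *)
Fixpoint charge_lb (l : seq entry) : Z :=
  if l is (K, _) :: l' then
    (psi (if has_key K l' then (size K).+2 else (size K).+1) + charge_lb l')%coqZ
  else 18%coqZ.

Fixpoint has_entry (K U : seq positive) (l : seq entry) : bool :=
  if l is (K', U') :: l' then
    if same K K' then if same U U' then true else has_entry K U l'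
    else has_entry K U l'
  else false.

Fixpoint conflict (l : seq entry) : bool :=
  if l is (K, U) :: l' then if has_entry K U l' then true else conflict l'
  else false.

(** The focus is one codeword, so the vertices counted need exactly one more, known already or still
    possible. *)
Fixpoint deg_ub (l : seq entry) : nat :=
  match l with
  | [::] => 0
  | ([::], _ :: _) :: l' | ([:: _], _) :: l' => (deg_ub l').+1
  | _ :: l' => deg_ub l'
  end.

Definition gift_lb (l : seq entry) : Z :=
  let L := charge_lb l in
  if Z.leb L 0 then 0%coqZ else (L * rate (deg_ub l))%coqZ.

(** Vertices with few undecided cells go first. With three known codewords besides the focus [psi]
    has reached its maximum, so such vertices need no branching; when [pick_cell] finds nothing,
    charge and degree of the focus are settled. *)
Fixpoint pick_from (l : seq entry) (best : nat) (bi : option positive) :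
    option positive :=
  match l with
  | [::] => bi
  | (_, [::]) :: l' => pick_from l' best bi
  | (K, i :: U) :: l' =>
    let try s := if (s < best)%N then pick_from l' s (Some i)
                 else pick_from l' best bi in
    match K with
    | [::] => try (size U).+1
    | [:: _] => try (size U)
    | [:: _; _] => try (20 + size U)%N
    | _ => pick_from l' best bi
    end
  end.

Definition pick_cell (l : seq entry) := pick_from l 100 None.

(* A lower bound, truncated at [cap], of the gift of the focus over all ways to
   decide the undecided cells. *)
Fixpoint gift_min (fuel : nat) (l : seq entry) (cap : Z) : Z :=
  if conflict l then cap else
  let g := gift_lb l in
  if Z.leb cap g then cap else
  if fuel is fuel'.+1 then
    if pick_cell l is Some i then
      let a := gift_min fuel' (decide i false l) cap in
      if Z.leb a g then g else gift_min fuel' (decide i true l) a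
    else g
  else g.

(** What earlier partners leave uncovered is the cap for the next one. *)
Fixpoint gifts_cover (ls : seq (seq entry)) (need : Z) : bool :=
  if Z.leb need 0 then true else
  if ls is l :: ls' then gifts_cover ls' (need - gift_min 60 l need)
  else false.

Fixpoint partners (l : seq entry) : seq positive :=
  match l with
  | [::] => [::]
  | ([:: i], [::]) :: l' => i :: partners l'
  | _ :: l' => partners l'
  end.

Fixpoint index_from (k : positive) (l : seq cell) (p : cell) : positive :=
  if l is a :: l' then if a == p then k else index_from (Pos.succ k) l' p else k.

Definition index4 : cell -> positive := index_from 1 disk4.

(** The focus is left out of every ball: it is always a codeword, and the bounds count it by adding
    one. *)
Definition balls4 : seq (seq positive) := Eval vm_compute in
  [seq [seq index4 p | p <- behead disk4 & Z.leb (cell_norm (p - u)) 2]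
  | u <- disk2].

Definition table4 : PositiveMap.t cell := Eval vm_compute in
  foldr (fun p m => PositiveMap.add (index4 p) p m) (PositiveMap.empty cell) disk4.

Definition cell4 (i : positive) : cell :=
  odflt 0 (PositiveMap.find i table4).

Definition sym_index (k : nat) (p : cell) : cell :=
  let: (x, y) := p in
  nth (x, y) [:: (x, y); (Z.opp y, x); (Z.opp x, Z.opp y); (y, Z.opp x);
                 (Z.opp x, y); (Z.opp y, Z.opp x); (x, Z.opp y); (y, x)] k.

Definition orbits4 : seq (seq (cell * cell)) := Eval vm_compute in
  [seq [seq (p, sym_index k p) | p <- behead disk4] | k <- iota 1 7].

Definition zkey (z : Z) : positive :=
  match z with Z0 => xH | Zpos p => xO p | Zneg p => xI p end.

Definition state := PositiveMap.t (PositiveMap.t bool).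

Definition lookup (st : state) (p : cell) : option bool :=
  if PositiveMap.find (zkey p.1) st is Some m then PositiveMap.find (zkey p.2) m
  else None.

Definition assign (st : state) (p : cell) (b : bool) : state :=
  let m := odflt (PositiveMap.empty bool) (PositiveMap.find (zkey p.1) st) in
  PositiveMap.add (zkey p.1) (PositiveMap.add (zkey p.2) b m) st.

Definition view (st : state) (x : cell) : seq entry :=
  let value i := let p := cell4 i in lookup st (Z.add x.1 p.1, Z.add x.2 p.2) in
  [seq ([seq i <- B | if value i is Some b then b else false],
        [seq i <- B | if value i is None then true else false]) | B <- balls4].

(* Among the 8 images of a configuration only one with the lexicographically
   least restriction to [disk4] has to be examined. *)
Fixpoint lex_gt (st : state) (l : seq (cell * cell)) : bool :=
  if l is (p, q) :: l' then
    match lookup st p, lookup st q with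
    | Some true, Some false => true
    | Some true, Some true | Some false, Some false => lex_gt st l'
    | Some false, Some true => false
    | _, _ => if p == q then lex_gt st l' else false
    end
  else false.

Definition noncanonical (st : state) : bool := has (lex_gt st) orbits4.

Fixpoint insert (a : Z * (cell * seq entry)) (s : seq (Z * (cell * seq entry))) :=
  if s is b :: s' then if Z.leb b.1 a.1 then a :: s else b :: insert a s'
  else [:: a].

Fixpoint pick_joint (s : seq (Z * (cell * seq entry))) : option cell :=
  if s is (_, (x, l)) :: s' then
    if pick_cell l is Some i then
      let p := cell4 i in Some (Z.add x.1 p.1, Z.add x.2 p.2)
    else pick_joint s'
  else None.

(** Sorted by decreasing charge bound, so that the partners likely to give most are examined
    first. *)
Definition partner_views (st : state) (l : seq entry) :
    seq (Z * (cell * seq entry)) :=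
  foldr insert [::]
    [seq (let x := cell4 i in let v := view st x in (charge_lb v, (x, v)))
    | i <- partners l].

(* Branches on the cells around 0 until its charge is known; if that is negative,
   adds up minimal gifts of the partners, and when this crude sum falls short
   branches further on a cell near a partner. *)
Fixpoint solvent (fuel : nat) (st : state) (l : seq entry) : bool :=
  if noncanonical st then true else
  if conflict l then true else
  let L := charge_lb l in
  if Z.leb 0 L then true else
  if fuel is fuel'.+1 then
    if pick_cell l is Some i then
      let p := cell4 i in
      if solvent fuel' (assign st p false) (decide i false l)
      then solvent fuel' (assign st p true) (decide i true l) else false
    else
    let vs := partner_views st l in
    if gifts_cover [seq v.2.2 | v <- vs] (Z.mul (-840) L) then true else
    if pick_joint vs is Some p then
      if solvent fuel' (assign st p false) l
      then solvent fuel' (assign st p true) l else false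
    else false
  else false.

Definition start : state := assign (PositiveMap.empty _) (Z0, Z0) true.

(** The complete case analysis, evaluated by the virtual machine; [solvent_income] gives it its
    meaning. *)
Lemma solvent_start : solvent 200 start (view start (Z0, Z0)).
Proof. by vm_cast_no_check (erefl true). Qed.

(** * Soundness of the bounds read off from entries *)

HB.instance Definition _ := hasDecEq.Build positive Pos.eqb_spec.

Lemma sameP (a b : seq positive) : reflect (a = b) (same a b).
Proof.
elim: a b => [|x a IHa] [|y b] /=; try by constructor.
case: (Pos.eqb_spec x y) => [->|ne]; last by constructor=> -[].
by apply: (iffP (IHa b)) => [->|[]].
Qed.

Section Views.

Variable g : pred positive.

Definition apart (B B' : seq positive) : Prop :=
  exists2 i, g i & (i \in B) != (i \in B').

(** The count serves the numerical bounds, the membership the separation arguments. *)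
Definition sound_entry (B : seq positive) (e : entry) : Prop :=
  count g B = (size e.1 + count g e.2)%N /\
  forall i, g i -> (i \in B) = (i \in e.1) || (i \in e.2).

Fixpoint sound (Bs : seq (seq positive)) (l : seq entry) : Prop :=
  match Bs, l with
  | [::], [::] => True
  | B :: Bs', e :: l' =>
    [/\ sound_entry B e, {in Bs', forall B', apart B B'} & sound Bs' l']
  | _, _ => False
  end.

Lemma extractE i s r : extract i s = Some r -> perm_eq s (i :: r).
Proof.
elim: s r => //= j s IHs r; case: (Pos.eqb_spec i j) => [<- [->] //|_].
case: extract IHs => // r' /(_ _ erefl) h [<-].
apply: (@perm_trans _ (j :: i :: r')); first by rewrite perm_cons.
by apply/permP => a /=; rewrite addnCA.
Qed.

Lemma sound_decide i Bs l : sound Bs l -> sound Bs (decide i (g i) l).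
Proof.
elim: Bs l => [|B Bs IHB] [|[K U] l] //= [hB hs /IHB hl]; split=> //.
case E: (extract i U) => [U'|] //; have hp := extractE E.
have [h1 h2] := hB; have hU := perm_mem hp.
have hc : count g U = (g i + count g U')%N by rewrite (permP hp).
split; first by rewrite h1 hc /=; case: (g i) => /=; lia.
move=> j gj; rewrite h2 //= hU inE; case gi: (g i); first by rewrite inE orbCA orbA.
suff /negPf -> : j != i by [].
by apply: contraFneq gi => <-.
Qed.

Lemma sound_no_entry B Bs K U l :
  sound_entry B (K, U) -> {in Bs, forall B', apart B B'} -> sound Bs l ->
  has_entry K U l = false.
Proof.
move=> [_ hB]; elim: Bs l => [|B' Bs IHB] [|[K' U'] l] //= hs [[_ hB'] _ hl].
have IH : has_entry K U l = false.
  by apply: IHB => // D hD; apply: hs; rewrite inE hD orbT.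
case: sameP => [eK|//]; case: sameP => [eU|//].
have [i gi /eqP[]] := hs _ (mem_head _ _).
by rewrite hB // hB' //= eK eU.
Qed.

Lemma sound_conflict Bs l : sound Bs l -> conflict l = false.
Proof.
elim: Bs l => [|B Bs IHB] [|[K U] l] //= [hB hs hl].
by rewrite (sound_no_entry hB hs hl) (IHB _ hl).
Qed.

Definition exact (K : seq positive) (e : entry) := (e.1 == K) && ~~ has g e.2.

(** Two balls with the same known codewords and no others would contain the same codewords, against
    [apart]. *)
Lemma exact_unique B Bs e l :
  sound_entry B e -> {in Bs, forall B', apart B B'} -> sound Bs l ->
  ~~ has g e.2 -> ~~ has (exact e.1) l.
Proof.
move=> [_ hB]; elim: Bs l => [|B' Bs IHB] [|e' l] //= hs [[_ hB'] _ hl] he.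
rewrite negb_or IHB // ?andbT => [|D hD]; last by apply: hs; rewrite inE hD orbT.
apply/negP => /andP[/eqP eK he'].
have [i gi /eqP[]] := hs _ (mem_head _ _).
rewrite hB // hB' // eK; congr (_ || _).
have out U : ~~ has g U -> (i \in U) = false.
  by apply: contraNF => hi; apply/hasP; exists i.
by rewrite !out.
Qed.

Lemma has_keyE K l : has_key K l = has (fun e => e.1 == K) l.
Proof.
elim: l => //= -[K' U] l -> /=.
by case: sameP => [->|/eqP]; rewrite ?eqxx // eq_sym => /negPf ->.
Qed.

Definition excess (K : seq positive) : Z := psi (size K).+2 - psi (size K).+1.

(* At most one vertex whose known codewords are [K] has no further codeword;
   [E] lists the keys for which that vertex is known to lie elsewhere. *)
Lemma charge_lb_excess Bs l (E : seq (seq positive)) :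
  sound Bs l -> uniq E -> {in E, forall K, has_key K l /\ ~~ has (exact K) l} ->
  charge_lb l + \sum_(K <- E) excess K <=
  18%coqZ + \sum_(B <- Bs) psi (count g B).+1.
Proof.
elim: Bs l E => [|B Bs IHB] [|[K U] l] E //=.
  move=> _ _ hE; rewrite !big_nil.
  by case: E hE => [|K E /(_ K (mem_head _ _))[]] //; rewrite big_nil.
move=> [hB hs hl] uE hE; rewrite big_cons.
have add (p c s q r : Z) : c + s <= 18%coqZ + r -> p <= q ->
  Z.add p c + s <= 18%coqZ + (q + r) by lia.
have add2 (p p' c s q r : Z) : c + s <= 18%coqZ + r -> p' <= q ->
  Z.add p c + (p' - p + s) <= 18%coqZ + (q + r) by lia.
have add3 (p p' c s q r : Z) : c + (p' - p + s) <= 18%coqZ + r -> p <= q ->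
  Z.add p' c + s <= 18%coqZ + (q + r) by lia.
have hcnt : (count g B).+1 = (size K + count g U).+1 by case: hB => -> _.
have psi1 : psi (size K).+1 <= psi (count g B).+1.
  by apply: psi_le => //; rewrite hcnt ltnS leq_addr.
have psi2 : has g U -> psi (size K).+2 <= psi (count g B).+1.
  rewrite has_count => hU; apply: psi_le => //; rewrite hcnt; lia.
have sub K' : K' \in E -> K' != K -> has_key K' l /\ ~~ has (exact K') l.
  move=> /hE[] h1; rewrite negb_or => /andP[_ h2] ne; split=> //.
  move: h1; rewrite -[if _ then _ else _]/(has_key K' ((K, U) :: l)) !has_keyE.
  by rewrite /= eq_sym (negPf ne).
have psi3 : psi (size K).+1 <= psi (size K).+2 by apply: psi_le.
(* No entry is exact for a key in [E], so if [K] is one, the undecided cells [U] hold a codeword. *)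
have [KE|KE] := boolP (K \in E).
  have [_ /=] := hE _ KE; rewrite negb_or => /andP[].
  rewrite /exact eqxx /= negbK => /psi2 hpsi nexact.
  case: ifP => hk.
    have hE' : {in E, forall K, has_key K l /\ ~~ has (exact K) l}.
      by move=> K' hK'; have [->|] := eqVneq K' K; [split|apply: sub].
    exact: add (IHB l E hl uE hE') hpsi.
  (* [K] is not a key of the tail: its excess is spent on this entry, and [K] leaves [E]. *)
  have hE' : {in rem K E, forall K, has_key K l /\ ~~ has (exact K) l}.
    by move=> K'; rewrite mem_rem_uniq // inE => /andP[ne hK']; apply: sub.
  have := IHB l (rem K E) hl (rem_uniq _ uE) hE'.
  rewrite (perm_big _ (perm_to_rem KE)) big_cons => h.
  exact: add2 h hpsi.
have hE' : {in E, forall K, has_key K l /\ ~~ has (exact K) l}.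
  by move=> K' hK'; apply: sub => //; apply: contraNneq KE => <-.
case: ifP => hk; last exact: add (IHB l E hl uE hE') psi1.
have [/psi2|hU] := boolP (has g U); first exact: add (IHB l E hl uE hE').
(* This entry is the one exact entry for [K]. It is overcounted, and [K] joins [E] so that the tail
   makes up for it. *)
have := IHB l (K :: E) hl.
rewrite /= KE uE big_cons => /(_ isT) h.
suff : {in K :: E, forall K, has_key K l /\ ~~ has (exact K) l} 
  by move=> /h{}h; apply: add3 h psi1.
move=> K'; rewrite inE => /predU1P[->|/hE'//]; split=> //.
exact: exact_unique hB hs hl hU.
Qed.

Definition local_charge (Bs : seq (seq positive)) : Z :=
  18%coqZ + \sum_(B <- Bs) psi (count g B).+1.

Lemma charge_lb_le Bs l : sound Bs l -> charge_lb l <= local_charge Bs.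
Proof.
move=> h; rewrite /local_charge; have := @charge_lb_excess Bs l [::] h isT.
by rewrite big_nil addr0; apply.
Qed.

Lemma deg_ub_ge Bs l :
  sound Bs l -> (count (fun B => (count g B).+1 == 2) Bs <= deg_ub l)%N.
Proof.
elim: Bs l => [|B Bs IHB] [|[K U] l] //= [[/= -> _] _ /IHB].
case: K => [|i [|j K]] /=; rewrite ?eqSS; case: U => [|k U] /=; lia.
Qed.

Definition local_gift (Bs : seq (seq positive)) : Z :=
  if local_charge Bs <= 0 then 0
  else local_charge Bs * rate (count (fun B => (count g B).+1 == 2) Bs).

(** A positive gift grows with the charge and shrinks as the degree grows. *)
Lemma gift_lb_le Bs l : sound Bs l -> gift_lb l <= local_gift Bs.
Proof.
move=> hl; have hc := charge_lb_le hl.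
rewrite /gift_lb /local_gift; case: Z.leb_spec0 => hL.
  by case: ifP => // /negbT; rewrite -ltNge => h; rewrite mulr_ge0 ?ltW ?rate_gt0.
case: ifP => h; first by lia.
apply: ler_pM => //; [lia|exact/ltW/rate_gt0|exact/rate_le/deg_ub_ge].
Qed.

(** A conflicting table is sound for no configuration, so it may return [cap]. The result of the
    first branch caps the second, which yields a bound for both. *)
Lemma gift_min_le fuel l cap :
  gift_min fuel l cap <= cap /\
  forall Bs, sound Bs l -> gift_min fuel l cap <= local_gift Bs.
Proof.
elim: fuel l cap => [|fuel IH] l cap /=.
  case: ifP => [hc|_]; first by split=> // Bs /sound_conflict; rewrite hc.
  case: Z.leb_spec0 => hg; split; [by []|move=> Bs /gift_lb_le; lia|lia|].
  by move=> Bs /gift_lb_le.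
case: ifP => [hc|_]; first by split=> // Bs /sound_conflict; rewrite hc.
case: Z.leb_spec0 => hg; first by split=> // Bs /gift_lb_le; lia.
have dflt : gift_lb l <= cap /\ (forall Bs, sound Bs l -> gift_lb l <= local_gift Bs).
  by split; [lia|move=> Bs /gift_lb_le].
case: pick_cell => [i|] //; case: Z.leb_spec0 => // ha.
have [h0 h1] := IH (decide i false l) cap.
have [h2 h3] := IH (decide i true l) (gift_min fuel (decide i false l) cap).
split; first lia.
move=> Bs hl; have := sound_decide i hl; case: (g i) => [/h3//|/h1]; lia.
Qed.

Lemma partners_le (h : positive -> Z) Bs l :
  (forall i, 0 <= h i) -> sound Bs l ->
  \sum_(i <- partners l) h i <=
  \sum_(B <- Bs | (count g B).+1 == 2) \sum_(i <- B | g i) h i.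
Proof.
move=> h0; elim: Bs l => [|B Bs IHB] [|[K U] l] //=; first by rewrite !big_nil.
move=> [[/= hc hm] _ /IHB hl]; rewrite [leRHS]big_cons.
have hB : 0 <= \sum_(i <- B | g i) h i by apply: sumr_ge0.
have dflt : \sum_(i <- partners l) h i <=
    if (count g B).+1 == 2 then \sum_(i <- B | g i) h i +
      \sum_(B <- Bs | (count g B).+1 == 2) \sum_(i <- B | g i) h i
    else \sum_(B <- Bs | (count g B).+1 == 2) \sum_(i <- B | g i) h i.
  by case: ifP => _ //; lia.
case: K hc hm => [|i [|]] //; case: U => [|k U] //= hc hm.
(* One known and no undecided cell: [i] is the only codeword of [B], so its term occurs in the sum
   over [B]. *)
rewrite big_cons hc /=; apply: lerD => //.
have [j jB gj] : exists2 j, j \in B & g j by apply/hasP; rewrite has_count hc.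
have := hm j gj; rewrite jB inE orbF => /esym/eqP eji; rewrite -eji.
rewrite (perm_big _ (perm_to_rem jB)) big_cons gj lerDl.
exact: sumr_ge0.
Qed.

End Views.

(** * Invariance under translations and symmetries *)

Section Transport.

Variables (f : pred cell) (c : cell) (s : cell -> cell).
Hypotheses (sD : {morph s : x y / x + y}) (s0 : forall x, s x = 0 -> x = 0).
Hypothesis s_disk2 : perm_eq [seq s d | d <- disk2] disk2.

Let phi p := c + s p.

Let phiD x d : phi (x + d) = phi x + s d.
Proof. by rewrite /phi sD addrA. Qed.

Lemma ball_transport u : perm_eq [seq phi z | z <- ball2 u] (ball2 (phi u)).
Proof.
rewrite /ball2 -map_comp; have := perm_map (fun d => phi u + d) s_disk2.
by rewrite -map_comp; apply: perm_trans; rewrite (eq_map (phiD u)).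
Qed.

Lemma card_transport u : card (f \o phi) u = card f (phi u).
Proof. by rewrite /card -(permP (ball_transport u)) count_map. Qed.

Lemma sum_transport (P : pred cell) (h : cell -> Z) :
  \sum_(d <- disk2 | P (s d)) h (s d) = \sum_(d <- disk2 | P d) h d.
Proof. by rewrite -[RHS](perm_big _ s_disk2) big_map. Qed.

Lemma charge_transport x : charge (f \o phi) x = charge f (phi x).
Proof.
rewrite /charge -(sum_transport xpredT (fun d => psi (card f (phi x + d)))).
congr (_ + _); apply: eq_bigr => d _.
by rewrite card_transport phiD.
Qed.

Lemma deg_transport x : deg (f \o phi) x = deg f (phi x).
Proof.
rewrite /deg -[RHS](permP s_disk2) count_map; apply: eq_count => d /=.
by rewrite card_transport phiD.
Qed.

Lemma gift_transport x : gift (f \o phi) x = gift f (phi x).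
Proof. by rewrite /gift charge_transport deg_transport. Qed.

Lemma income_transport x : income (f \o phi) x = income f (phi x).
Proof.
rewrite /income -(sum_transport (fun d => card f (phi x + d) == 2)).
apply: eq_big => d; first by rewrite card_transport phiD.
move=> _; rewrite -(sum_transport (fun e => f (phi x + s d + e) && (s d + e != 0))).
apply: eq_big => e; rewrite ?gift_transport /= !phiD // -sD.
congr (_ && ~~ _); apply/eqP/eqP => [->|/s0 //].
by apply: (addrI (s 0)); rewrite -sD !addr0.
Qed.

Lemma separated_transport x : separated f (phi x) -> separated (f \o phi) x.
Proof.
move=> sep d e hd he ne.
have sM y : y \in disk2 -> s y \in disk2.
  by move=> hy; rewrite -(perm_mem s_disk2) map_f.
have sI : injective s.
  move=> y z eyz; apply/eqP; rewrite -subr_eq0; apply/eqP/s0/(addIr (s z)).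
  by rewrite -sD subrK eyz add0r.
have [z fz hz] : exists2 z, f z & (z \in ball2 (phi x + s d)) != (z \in ball2 (phi x + s e)).
  by apply: sep; rewrite ?sM // (inj_eq sI).
have memE y u : (phi y \in ball2 (phi u)) = (y \in ball2 u).
  by rewrite -(perm_mem (ball_transport u)) mem_map // => a b /addrI/sI.
(* [s] is not assumed surjective, but [z] lies in one of the two balls, and these are images of
   balls under [phi]. *)
have [y zy] : exists y, z = phi y.
  have [hzd|hzd] := boolP (z \in ball2 (phi x + s d)).
    move: hzd; rewrite -phiD -(perm_mem (ball_transport _)) => /mapP[y _ ->].
    by exists y.
  move: hz; rewrite (negPf hzd) eq_sym eqbF_neg negbK -phiD.
  by rewrite -(perm_mem (ball_transport _)) => /mapP[y _ ->]; exists y.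
exists y; first by rewrite /= -/(phi y) -zy.
by rewrite -(memE y (x + d)) -(memE y (x + e)) !phiD -zy.
Qed.

End Transport.

(** * Partial configurations and canonical orientation *)

Lemma lookup_assign st p b q :
  lookup (assign st p b) q = if q == p then Some b else lookup st q.
Proof.
have zkI : injective zkey by move=> [|x|x] [|y|y] //= [->].
rewrite /lookup /assign.
have [->|ne] := eqVneq q p; first by rewrite !PositiveMap.gss.
have [e1|/eqP ne1] := eqVneq q.1 p.1; last first.
  by rewrite PositiveMap.gso // => /zkI.
rewrite e1 PositiveMap.gss PositiveMap.gso.
  by case: (PositiveMap.find _ st) => //=; rewrite PositiveMap.gempty.
move=> /zkI e2; case/eqP: ne; case: q p e1 e2 => [q1 q2] [p1 p2] /= -> ->.
by [].
Qed.

Definition agrees (F : pred cell) (st : state) : Prop :=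
  forall p b, lookup st p = Some b -> F p = b.

Lemma agrees_assign F st p : agrees F st -> agrees F (assign st p (F p)).
Proof.
by move=> h q b; rewrite lookup_assign; case: eqP => [-> []|_ /h].
Qed.

(** Binary numbers turn the lexicographic order of equally long words into the order of [nat]. *)
Fixpoint bits (s : seq bool) : nat :=
  if s is b :: s' then (b * 2 ^ size s' + bits s')%N else 0.

Lemma bits_lt s : (bits s < 2 ^ size s)%N.
Proof.
elim: s => //= b s IHs; rewrite expnS mul2n -addnn -addnS leq_add //.
by case: b; rewrite ?mul1n.
Qed.

Definition canonical (F : pred cell) : Prop :=
  forall k, (k < 8)%N -> (bits [seq F p | p <- behead disk4] <=
    bits [seq F (sym_index k p) | p <- behead disk4])%N.

(** Up to the deciding pair both words agree, undecided cells being passed over only when the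
    symmetry fixes them; there the leading bit outweighs the rest by [bits_lt]. *)
Lemma lex_gt_bits F st l : agrees F st -> lex_gt st l ->
  (bits [seq F z.2 | z <- l] < bits [seq F z.1 | z <- l])%N.
Proof.
move=> ag; elim: l => //= -[p q] l IHl /=.
have skip : F p = F q -> lex_gt st l ->
    (F q * 2 ^ size [seq F z.2 | z <- l] + bits [seq F z.2 | z <- l] <
     F p * 2 ^ size [seq F z.1 | z <- l] + bits [seq F z.1 | z <- l])%N.
  by move=> -> /IHl; rewrite !size_map ltn_add2l.
case ep: (lookup st p) => [a|]; last first.
  by case: eqP => // e h; apply: skip h; rewrite e.
case eq: (lookup st q) => [b|]; last first.
  by case: a ep => _; case: eqP => // e h; apply: skip h; rewrite e.
have Fp := ag _ _ ep; have Fq := ag _ _ eq.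
case: a b Fp Fq {ep eq} => [] [] Fp Fq //; try by move=> h; apply: skip h; rewrite Fp Fq.
move=> _; rewrite Fp Fq mul0n mul1n add0n.
by apply: leq_trans (leq_addr _ _); rewrite (leq_trans (bits_lt _)) // !size_map.
Qed.

Lemma orbits4E :
  orbits4 = [seq [seq (p, sym_index k p) | p <- behead disk4] | k <- iota 1 7].
Proof. by vm_compute. Qed.

Lemma canonical_state F st : agrees F st -> canonical F -> noncanonical st = false.
Proof.
move=> ag can; apply/negbTE/hasPn => o; rewrite orbits4E => /mapP[k].
rewrite mem_iota => /andP[_ hk] ->; apply/negP => /(lex_gt_bits ag).
by rewrite -!map_comp ltnNge => /negP[]; apply: can.
Qed.

Lemma sym_index_comp j k : (j < 8)%N -> (k < 8)%N ->
  exists2 m, (m < 8)%N & forall p, sym_index j (sym_index k p) = sym_index m p.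
Proof.
move=> hj hk.
(* The multiplication table of the dihedral group of order 8 in the numbering of [sym_index]. *)
pose m := nth 0%N (nth [::] [:: [:: 0; 1; 2; 3; 4; 5; 6; 7];
  [:: 1; 2; 3; 0; 5; 6; 7; 4];
  [:: 2; 3; 0; 1; 6; 7; 4; 5];
  [:: 3; 0; 1; 2; 7; 4; 5; 6];
  [:: 4; 7; 6; 5; 0; 3; 2; 1];
  [:: 5; 4; 7; 6; 1; 0; 3; 2];
  [:: 6; 5; 4; 7; 2; 1; 0; 3];
  [:: 7; 6; 5; 4; 3; 2; 1; 0]] j) k.
exists m.
  by rewrite /m {m}; do 8![case: j hj => [|j] hj;
    first by do 8![case: k hk => [|k] hk //]].
move=> [x y]; rewrite /m {m}.
by do 8![case: j hj => [|j] hj; first by do 8![case: k hk => [|k] hk;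
  first by rewrite /= ?Z.opp_involutive]].
Qed.

(** The image with the least code is canonical because the symmetries are closed under
    composition. *)
Lemma canonical_ex F : exists2 k, (k < 8)%N & canonical (F \o sym_index k).
Proof.
pose code k := bits [seq F (sym_index k p) | p <- behead disk4].
case: (@arg_minnP _ (@ord0 7) xpredT (fun k : 'I_8 => code k) isT) => k _ kmin.
exists k => // j hj; have [m hm ekj] := sym_index_comp (ltn_ord k) hj.
have -> : [seq (F \o sym_index k) (sym_index j p) | p <- behead disk4] =
          [seq F (sym_index m p) | p <- behead disk4].
  by apply: eq_map => p /=; rewrite ekj.
exact: kmin (Ordinal hm) isT.
Qed.

Lemma sym_index_morph k : {morph sym_index k : x y / x + y}.
Proof.
move=> [x1 x2] [y1 y2]; rewrite /sym_index.
do 8![case: k => [|k]; first by congr (_, _) => /=; lia].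
by rewrite /= !nth_nil.
Qed.

Lemma sym_index_eq0 k x : sym_index k x = 0 -> x = 0.
Proof.
case: x => x y; rewrite /sym_index.
do 8![case: k => [|k]; first by move=> [h1 h2]; congr (_, _); lia].
by rewrite /= !nth_nil.
Qed.

Lemma sym_index_disk2 k :
  (k < 8)%N -> perm_eq [seq sym_index k d | d <- disk2] disk2.
Proof.
have : all (fun k => perm_eq [seq sym_index k d | d <- disk2] disk2) (iota 0 8).
  by vm_compute.
by move=> /allP h hk; apply: h; rewrite mem_iota.
Qed.

(** * Tables around a focus in the plane *)

Definition local (F : pred cell) (x : cell) : pred positive := fun i => F (x + cell4 i).

Definition ball_indices (u : cell) (B : seq positive) : bool :=
  perm_eq (0 :: [seq cell4 i | i <- B]) (ball2 u) && all (fun i => cell4 i != 0) B.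

Lemma balls4P : all2 ball_indices disk2 balls4.
Proof. by vm_compute. Qed.

Lemma sum_all2 (T U : Type) (R : T -> U -> bool) (s : seq T) (t : seq U)
    (P : pred T) (Q : pred U) (h : T -> Z) (k : U -> Z) :
  all2 R s t -> (forall x y, R x y -> P x = Q y) ->
  (forall x y, R x y -> h x = k y) ->
  \sum_(x <- s | P x) h x = \sum_(y <- t | Q y) k y.
Proof.
move=> hst hPQ hk; elim: s t hst => [|x s IHs] [|y t] //= => [_|/andP[hxy /IHs e]].
  by rewrite !big_nil.
by rewrite !big_cons (hPQ _ _ hxy) (hk _ _ hxy) e.
Qed.

Lemma ball_add x u : ball2 (x + u) = [seq x + z | z <- ball2 u].
Proof. by rewrite /ball2 -map_comp; apply: eq_map => d /=; rewrite addrA. Qed.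

Lemma card_local (F : pred cell) x u B :
  F x -> ball_indices u B -> card F (x + u) = (count (local F x) B).+1.
Proof.
move=> Fx /andP[pB _]; rewrite /card ball_add count_map -(permP pB) /= addr0 Fx.
by rewrite count_map.
Qed.

Lemma charge_local (F : pred cell) x : F x -> local_charge (local F x) balls4 = charge F x.
Proof.
move=> Fx; rewrite /local_charge /charge; congr (_ + _); apply/esym.
by apply: (sum_all2 balls4P) => // u B hB; rewrite (card_local Fx hB).
Qed.

Lemma gift_local (F : pred cell) x : F x -> local_gift (local F x) balls4 = gift F x.
Proof.
move=> Fx; rewrite /local_gift /gift charge_local //; congr (if _ then _ else _ * rate _).
apply/esym; rewrite /deg; move: balls4P; elim: disk2 balls4 => [|u s IHs] [|B t] //=.
by move=> /andP[hB /IHs ->]; rewrite (card_local Fx hB).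
Qed.

Lemma income_local (F : pred cell) :
  F 0 -> income F 0 =
  \sum_(B <- balls4 | (count (local F 0) B).+1 == 2)
    \sum_(i <- B | local F 0 i) gift F (cell4 i).
Proof.
move=> F0; apply: (sum_all2 balls4P) => u B hB.
  by rewrite (card_local F0 hB).
rewrite add0r; have /andP[pB nB] := hB.
transitivity (\sum_(z <- ball2 u | F z && (z != 0)) gift F z); first by rewrite big_map.
rewrite -(perm_big _ pB) big_cons eqxx andbF big_map big_seq_cond [RHS]big_seq_cond.
apply: eq_bigl => i; rewrite /local add0r; have [hi|//] := boolP (i \in B).
by rewrite (allP nB) // andbT.
Qed.

(** The separating codeword is not [x], which lies in both balls; hence it has an index in exactly
    one of the lists. *)
Lemma apart_local (F : pred cell) x u v B B' :
  F x -> separated F x -> u \in disk2 -> v \in disk2 -> u != v ->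
  ball_indices u B -> ball_indices v B' -> apart (local F x) B B'.
Proof.
move=> Fx sep hu hv ne /andP[pu _] /andP[pv _].
have mem w D z : perm_eq (0 :: [seq cell4 i | i <- D]) (ball2 w) ->
    (z \in ball2 (x + w)) = (z - x \in 0 :: [seq cell4 i | i <- D]).
  move=> pw; rewrite ball_add (perm_mem pw); apply/mapP/idP => [[y hy ->]|h].
    by rewrite addrAC subrr add0r.
  by exists (z - x) => //; rewrite addrC subrK.
have half w w' D D' z : perm_eq (0 :: [seq cell4 i | i <- D]) (ball2 w) ->
    perm_eq (0 :: [seq cell4 i | i <- D']) (ball2 w') -> F z ->
    z \in ball2 (x + w) -> z \notin ball2 (x + w') ->
    exists2 i, local F x i & (i \in D) && (i \notin D').
  move=> pw pw' Fz; rewrite (mem _ _ _ pw) (mem _ _ _ pw') !inE negb_or.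
  move=> h /andP[z0]; move: h; rewrite (negPf z0) => /mapP[i hi ei] h.
  exists i; first by rewrite /local -ei addrC subrK.
  by rewrite hi; apply: contra h => hi'; rewrite ei map_f.
have [z Fz hz] := sep u v hu hv ne.
have [zu|zu] := boolP (z \in ball2 (x + u)).
  have zv : z \notin ball2 (x + v) by move: hz; rewrite zu; case: (_ \in _).
  by have [i gi /andP[h1 h2]] := half _ _ _ _ _ pu pv Fz zu zv; exists i; rewrite ?h1 ?(negPf h2).
have zv : z \in ball2 (x + v) by move: hz; rewrite (negPf zu); case: (_ \in _).
by have [i gi /andP[h1 h2]] := half _ _ _ _ _ pv pu Fz zv zu; exists i; rewrite ?h1 ?(negPf h2).
Qed.

Lemma sound_view (F : pred cell) st x :
  agrees F st -> F x -> separated F x -> sound (local F x) balls4 (view st x).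
Proof.
move=> ag Fx sep; rewrite /view.
have ent B : sound_entry (local F x) B
    ([seq i <- B |
       if lookup st (Z.add x.1 (cell4 i).1, Z.add x.2 (cell4 i).2) is Some b then b else false],
     [seq i <- B |
       if lookup st (Z.add x.1 (cell4 i).1, Z.add x.2 (cell4 i).2) is None then true else false]).
  have agi i b : lookup st (Z.add x.1 (cell4 i).1, Z.add x.2 (cell4 i).2) = Some b ->
      local F x i = b by move=> /ag <-.
  split=> [|i gi] /=.
    elim: B => //= i B ->; have := agi i.
    by case: lookup => [[]|] /= => [/(_ _ erefl) ->|/(_ _ erefl) ->|_] //; rewrite ?addSn //; lia.
  rewrite !mem_filter; have := agi i; case: lookup => [b /(_ _ erefl)|_]; last by [].
  by rewrite gi => <-; rewrite orbF.
have : all (mem disk2) disk2 by apply/allP.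
have : uniq disk2 by vm_compute.
(* The third [disk2] stays fixed during the induction: [separated] needs all centres to lie in
   it. *)
move: balls4P; elim: {1 2 4}disk2 balls4 => [|u s IHs] [|B t] //=.
move=> /andP[hB hst] /andP[us uns] /andP[hu hs]; split; [exact: ent| |exact: IHs].
move=> B' hB'; have [v hv hvB] : exists2 v, v \in s & ball_indices v B'.
  elim: s t hst hB' {IHs us uns hs} => [|v s IHs] [|D t] //= /andP[hD hst].
  rewrite inE => /predU1P[->|/(IHs _ hst)[w hw hwB]]; first by exists v; rewrite ?mem_head.
  by exists w; rewrite // inE hw orbT.
apply: (apart_local Fx sep hu _ _ hB hvB); first exact: (allP hs).
by apply: contraNneq us => ->.
Qed.

(** * Correctness of the search *)

Lemma perm_insert s : perm_eq (foldr insert [::] s) s.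
Proof.
have ins a l : perm_eq (insert a l) (a :: l).
  elim: l => //= b l IHl; case: ifP => // _.
  apply: (@perm_trans _ (b :: a :: l)); first by rewrite perm_cons.
  by apply/permP => p /=; rewrite addnCA.
by elim: s => //= a s IHs; apply: perm_trans (ins _ _) _; rewrite perm_cons.
Qed.

Lemma partners_sound (g : pred positive) Bs l :
  sound g Bs l -> {in partners l, forall i, g i}.
Proof.
elim: Bs l => [|B Bs IHB] [|[K U] l] //= [[/= hc hm] _ /IHB hl].
case: K hc hm => [|i [|]] //; case: U => [|k U] //= hc hm j.
rewrite inE => /predU1P[->|/hl//].
have [k kB gk] : exists2 k, k \in B & g k by apply/hasP; rewrite has_count hc.
by have := hm k gk; rewrite kB inE orbF => /esym/eqP <-.
Qed.

Arguments gift_min : simpl never.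
Arguments sound : simpl never.

Lemma gifts_cover_le (T : eqType) (V : T -> seq entry) (h : T -> Z) (s : seq T) need :
  (forall v, 0 <= h v) ->
  {in s, forall v cap, gift_min 60 (V v) cap <= h v} ->
  gifts_cover [seq V v | v <- s] need -> need <= \sum_(v <- s) h v.
Proof.
move=> h0; elim: s need => [|v s IHs] need hs /=.
  by rewrite big_nil; case: Z.leb_spec0 => //; lia.
rewrite big_cons; case: Z.leb_spec0 => [le0 _|_ /IHs].
  have add0 (a b c : Z) : Z.le a 0 -> 0 <= b -> 0 <= c -> a <= b + c by lia.
  by apply: add0 => //; apply: sumr_ge0.
move=> IH; have {}IH := IH (fun w hw => hs w (@mem_behead _ (v :: s) w hw)).
have add (a b c d : Z) : Z.sub a b <= d -> b <= c -> a <= c + d by lia.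
exact: add IH (hs v (mem_head _ _) need).
Qed.

(** The nested conditionals of [solvent] spare the second branch after a failure under strict
    evaluation; here they read as conjunctions. *)
Lemma solventE fuel st l :
  solvent fuel st l =
  if noncanonical st then true else
  if conflict l then true else
  if Z.leb 0 (charge_lb l) then true else
  if fuel is fuel'.+1 then
    if pick_cell l is Some i then
      solvent fuel' (assign st (cell4 i) false) (decide i false l) &&
      solvent fuel' (assign st (cell4 i) true) (decide i true l)
    else
    if gifts_cover [seq v.2.2 | v <- partner_views st l] (Z.mul (-840) (charge_lb l))
    then true
    else if pick_joint (partner_views st l) is Some p then
      solvent fuel' (assign st p false) l && solvent fuel' (assign st p true) l
    else false
  else false.
Proof. by case: fuel. Qed.

Arguments solvent : simpl never.

Lemma partner_views_income (F : pred cell) st l need :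
  F 0 -> (forall x, F x -> separated F x) ->
  agrees F st -> sound (local F 0) balls4 l ->
  gifts_cover [seq v.2.2 | v <- partner_views st l] need -> need <= income F 0.
Proof.
move=> F0 sep ag hl hg.
pose h (v : Z * (cell * seq entry)) := gift F v.2.1.
have le1 : need <= \sum_(v <- partner_views st l) h v.
  apply: (@gifts_cover_le _ (fun v => v.2.2) h _ _ _ _ hg) => [v|v]; first exact: gift_ge0.
  rewrite /partner_views (perm_mem (perm_insert _)) => /mapP[i hi ->] cap.
  have := partners_sound hl hi; rewrite /local add0r => Fi.
  rewrite /h -gift_local //.
  exact: (gift_min_le (local F (cell4 i)) 60 _ cap).2 (sound_view ag Fi (sep _ Fi)).
apply: le_trans le1 _; rewrite (perm_big _ (perm_insert _)) big_map income_local //.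
exact: (partners_le (fun i => gift_ge0 F (cell4 i)) hl).
Qed.

(** Pruning by symmetry or conflict cannot happen for a canonical separated [F]; the other
    successful leaves have a nonnegative charge or sufficient gifts. *)
Lemma solvent_income fuel st l (F : pred cell) :
  solvent fuel st l -> agrees F st -> sound (local F 0) balls4 l -> canonical F ->
  F 0 -> (forall x, F x -> separated F x) -> 0 <= 840%coqZ * charge F 0 + income F 0.
Proof.
move=> + + + can F0 sep; have : 0 <= income F 0.
  by apply: sumr_ge0 => d _; apply: sumr_ge0 => e _; apply: gift_ge0.
move: (charge F 0) (charge_local F0) => q qE.
move: (income F 0) (@partner_views_income F) => w wle w0.
elim: fuel st l => [|fuel IH] st l; rewrite solventE => + ag hl;
  rewrite (canonical_state ag can) (sound_conflict hl);
  have := charge_lb_le hl; rewrite qE;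
  case: Z.leb_spec0 => hL hc; try by move=> _; lia.
  by [].
case: pick_cell => [i|].
  have Fi : local F 0 i = F (cell4 i) by rewrite /local add0r.
  (* Only the branch with the true value of [F] keeps agreement and soundness. *)
  have := @agrees_assign F st (cell4 i) ag; have := sound_decide i hl; rewrite Fi.
  by case: (F _) => hl' ag' /andP[h1 h2]; [apply: IH h2 ag' hl'|apply: IH h1 ag' hl'].
case: ifP => [hg _|_].
  have := wle _ _ _ F0 sep ag hl hg; lia.
(* The charge at 0 is settled, so [l] is kept and only [st] records the new cell. *)
case: pick_joint => // p; have := @agrees_assign F st p ag.
by case: (F p) => ag' /andP[h1 h2]; [apply: IH h2 ag' hl|apply: IH h1 ag' hl].
Qed.

Theorem charge_income (f : pred cell) (c : cell) :
  f c -> (forall x, f x -> separated f x) -> 0 <= 840%coqZ * charge f c + income f c.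
Proof.
move=> fc sep; have [k hk can] := canonical_ex (fun p => f (c + p)).
(* [c] moves to the origin and the pattern into canonical position, so that the single computation
   applies. *)
pose F := f \o (fun p => c + sym_index k p).
have sD := @sym_index_morph k; have s0 := @sym_index_eq0 k.
have sp := sym_index_disk2 hk.
have e0 : c + sym_index k 0 = c.
  by rewrite -[in RHS](addr0 c); congr (_ + _); apply: (addrI (sym_index k 0)); rewrite -sD !addr0.
have <- : charge F 0 = charge f c by rewrite charge_transport // e0.
have <- : income F 0 = income f c by rewrite income_transport // e0.
have F0 : F 0 by rewrite /F /= e0.
have sepF x : F x -> separated F x by move=> Fx; apply: separated_transport => //; apply: sep.
have ag : agrees F start.
  move=> p b; rewrite lookup_assign; case: eqP => [-> [<-]//|_].
  by rewrite /lookup PositiveMap.gempty.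
by apply: solvent_income solvent_start ag (sound_view ag F0 (sepF _ F0)) _ F0 sepF.
Qed.

(** * Sums over boxes and their behaviour under shifts *)

Definition axis (n i : nat) : Z := Z.sub (Z.of_nat i) (Z.of_nat n).

Definition box_sum (n : nat) (h : cell -> Z) : Z :=
  \sum_(0 <= i < n.*2.+1) \sum_(0 <= j < n.*2.+1) h (axis n i, axis n j).

Definition side (n : nat) : Z := Z.of_nat n.*2.+1.

Lemma box_sumD n h k : box_sum n (fun p => h p + k p) = box_sum n h + box_sum n k.
Proof.
by rewrite /box_sum -big_split; apply: eq_bigr => i _; rewrite -big_split.
Qed.

Lemma box_sumZ n (a : Z) h : box_sum n (fun p => a * h p) = a * box_sum n h.
Proof.
by rewrite /box_sum big_distrr; apply: eq_bigr => i _; rewrite big_distrr.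
Qed.

Lemma box_sum_le n h k : (forall p, h p <= k p) -> box_sum n h <= box_sum n k.
Proof. by move=> hk; apply: ler_sum => i _; apply: ler_sum. Qed.

Lemma eq_box_sum n h k : h =1 k -> box_sum n h = box_sum n k.
Proof. by move=> hk; apply: eq_bigr => i _; apply: eq_bigr => j _; apply: hk. Qed.

Lemma sum_const_nat (m : nat) (a : Z) : \sum_(0 <= i < m) a = Z.of_nat m * a.
Proof.
elim: m => [|m IHm]; first by rewrite big_geq.
by transitivity (Z.of_nat m * a + a); [rewrite big_nat_recr // IHm|nia].
Qed.

Lemma box_sum_const n (a : Z) : box_sum n (fun=> a) = side n * side n * a.
Proof.
rewrite /box_sum -mulrA -!sum_const_nat.
by apply: eq_bigr => i _; rewrite sum_const_nat.
Qed.

(** The two sums differ by [b m - b 0] only. *)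
Lemma sum_shift_le (m : nat) (b : nat -> Z) (M : Z) :
  (forall i, 0 <= b i <= M) ->
  \sum_(0 <= i < m) b i.+1 <= \sum_(0 <= i < m) b i + M /\
  \sum_(0 <= i < m) b i <= \sum_(0 <= i < m) b i.+1 + M.
Proof.
move=> hb; have e : \sum_(0 <= i < m) b i.+1 + b 0 = \sum_(0 <= i < m) b i + b m.
  by rewrite addrC -big_nat_recl // big_nat_recr.
move: e (hb 0) (hb m); move: (\sum_(0 <= i < m) b i) (\sum_(0 <= i < m) b i.+1).
move=> s t; lia.
Qed.

(** The loss has the order of the perimeter, with a constant [k] depending on [d] alone. *)
Definition shiftable (d : cell) : Prop :=
  exists2 k : Z, 0 <= k & forall (M : Z) h n, (forall p, 0 <= h p <= M) ->
    box_sum n (fun p => h (p + d)) <= box_sum n h + k * M * side n.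

Lemma shiftable0 : shiftable 0.
Proof.
exists 0 => // M h n _; rewrite !mul0r addr0.
by under eq_box_sum do rewrite addr0.
Qed.

Lemma shiftableD d e : shiftable d -> shiftable e -> shiftable (d + e).
Proof.
move=> [k k0 hk] [l l0 hl]; exists (k + l); first exact: addr_ge0.
move=> M h n hM.
have h1 := hk M (fun p => h (p + e)) n (fun p => hM _); have h2 := hl M h n hM.
have -> : box_sum n (fun p => h (p + (d + e))) = box_sum n (fun p => h (p + d + e)).
  by apply: eq_box_sum => p; rewrite addrA.
apply: le_trans h1 _; rewrite !mulrDl [k * _ * _ + _]addrC addrA lerD2r.
exact: h2.
Qed.

Lemma shiftable_nat d n : shiftable d -> shiftable (d *+ n).
Proof.
move=> hd; elim: n => [|n IHn]; first exact: shiftable0.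
by rewrite mulrS; apply: shiftableD.
Qed.

Lemma axisS n i : axis n i.+1 = axis n i + 1.
Proof. by rewrite /axis; lia. Qed.

Lemma row_bound n (a : nat -> Z) (M : Z) : (forall i, 0 <= a i <= M) ->
  0 <= \sum_(0 <= j < n.*2.+1) a j <= M * side n.
Proof.
move=> ha; rewrite sumr_ge0 => [|i _]; last by case/andP: (ha i).
rewrite mulrC /side -sum_const_nat; apply: ler_sum => i _.
by case/andP: (ha i).
Qed.

Lemma shiftable_unit : [/\ shiftable (1, 0), shiftable (-1, 0),
  shiftable (0, 1) & shiftable (0, -1)].
Proof.
have axisS n i : axis n i.+1 = axis n i + 1 by rewrite /axis; lia.
have axisK n i : axis n i.+1 - 1 = axis n i by rewrite axisS addrK.
split; exists 1 => // M h n hM; rewrite mul1r.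
- pose b i := \sum_(0 <= j < n.*2.+1) h (axis n i, axis n j).
  have [h1 _] := @sum_shift_le n.*2.+1 b (M * side n) (fun i => row_bound n (fun j => hM _)).
  rewrite (_ : box_sum _ _ = \sum_(0 <= i < n.*2.+1) b i.+1) //.
  by apply: eq_bigr => i _; apply: eq_bigr => j _; rewrite axisS -[axis n j in RHS]addr0.
(* With [b] shifted back in advance, the negative step becomes the second inequality of
   [sum_shift_le]. *)
- pose b i := \sum_(0 <= j < n.*2.+1) h (axis n i - 1, axis n j).
  have [_ h1] := @sum_shift_le n.*2.+1 b (M * side n) (fun i => row_bound n (fun j => hM _)).
  rewrite (_ : box_sum _ _ = \sum_(0 <= i < n.*2.+1) b i).
    rewrite (_ : box_sum n h = \sum_(0 <= i < n.*2.+1) b i.+1) //.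
    by apply: eq_bigr => i _; apply: eq_bigr => j _; rewrite axisK.
  by apply: eq_bigr => i _; apply: eq_bigr => j _; rewrite -[axis n j in RHS]addr0.
- pose b i j := h (axis n i, axis n j).
  have h1 i := (@sum_shift_le n.*2.+1 (b i) M (fun j => hM _)).1.
  rewrite [leRHS](_ : _ = \sum_(0 <= i < n.*2.+1) (\sum_(0 <= j < n.*2.+1) b i j + M)).
    apply: ler_sum => i _; apply: le_trans (h1 i).
    rewrite le_eqVlt; apply/orP; left; apply/eqP.
    by apply: eq_bigr => j _; rewrite /b axisS -[axis n i in RHS]addr0.
  by rewrite big_split /= sum_const_nat mulrC.
- pose b i j := h (axis n i, axis n j - 1).
  have h1 i := (@sum_shift_le n.*2.+1 (b i) M (fun j => hM _)).2.
  rewrite [leRHS](_ : _ = \sum_(0 <= i < n.*2.+1) (\sum_(0 <= j < n.*2.+1) b i j.+1 + M)).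
    apply: ler_sum => i _; apply: le_trans (h1 i).
    rewrite le_eqVlt; apply/orP; left; apply/eqP.
    by apply: eq_bigr => j _; rewrite /b -[axis n i in RHS]addr0.
  rewrite big_split /= sum_const_nat mulrC; congr (_ + _).
  by apply: eq_bigr => i _; apply: eq_bigr => j _; rewrite /b axisK.
Qed.

Lemma shiftable_all d : shiftable d.
Proof.
have [h1 h2 h3 h4] := shiftable_unit.
have mul (a b : Z) n : (a, b) *+ n = (a *+ n, b *+ n) :> cell.
  by elim: n => // n IHn; rewrite !mulrS IHn.
have nat_abs (a : Z) : a = 1 *+ Z.abs_nat a \/ a = -1 *+ Z.abs_nat a.
  have [a0|a0] := Z.leb_spec0 0 a; [left|right]; lia.
case: d => a b; have -> : (a, b) = (a, 0) + (0, b) :> cell.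
  by congr (_, _); rewrite /= ?addr0 ?add0r.
apply: shiftableD.
  have [->|->] := nat_abs a.
    by have := shiftable_nat (Z.abs_nat a) h1; rewrite mul mul0rn.
  by have := shiftable_nat (Z.abs_nat a) h2; rewrite mul mul0rn.
have [->|->] := nat_abs b.
  by have := shiftable_nat (Z.abs_nat b) h3; rewrite mul mul0rn.
by have := shiftable_nat (Z.abs_nat b) h4; rewrite mul mul0rn.
Qed.

(* Mass transport: the mass [h i] may be recorded at its source or at its
   target, up to a boundary term. *)
Lemma mass_transport (I : Type) (r : seq I) (d : I -> cell) (h : I -> cell -> Z)
    (M : Z) :
  (forall i p, 0 <= h i p <= M) ->
  exists K : Z, forall n, box_sum n (fun p => \sum_(i <- r) h i (p + d i)) <=
    box_sum n (fun p => \sum_(i <- r) h i p) + K * side n.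
Proof.
move=> hM; elim: r => [|i r [K hK]].
  exists 0 => n; rewrite mul0r addr0 le_eqVlt; apply/orP; left; apply/eqP.
  by apply: eq_box_sum => p; rewrite !big_nil.
have [k _ hk] := shiftable_all (d i); exists (k * M + K) => n.
(* Both sides of the claim are instances, with [a] the identity and [a] zero. *)
have e (a : cell -> cell) : box_sum n (fun p => \sum_(j <- i :: r) h j (p + a (d j))) =
    box_sum n (fun p => h i (p + a (d i))) + box_sum n (fun p => \sum_(j <- r) h j (p + a (d j))).
  by rewrite -box_sumD; apply: eq_box_sum => p; rewrite big_cons.
have e0 s : box_sum n (fun p => \sum_(j <- s) h j p) =
    box_sum n (fun p => \sum_(j <- s) h j (p + 0)).
  by apply: eq_box_sum => p; apply: eq_bigr => j _; rewrite addr0.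
rewrite (e id) [in leRHS]e0 (e (fun=> 0)) -e0.
have h1 := hk M (h i) n (hM i); have h2 := hK n.
have -> : box_sum n (fun p => h i (p + 0)) = box_sum n (h i).
  by apply: eq_box_sum => p; rewrite addr0.
by rewrite mulrDl addrACA; apply: lerD.
Qed.

(** * Double counting of charges and gifts *)

Lemma disk2_uniq : uniq disk2.
Proof. by vm_compute. Qed.

Lemma disk2_opp : perm_eq [seq - d | d <- disk2] disk2.
Proof. by vm_compute. Qed.

Lemma sum_disk2_opp (h : cell -> Z) :
  \sum_(d <- disk2) h (- d) = \sum_(d <- disk2) h d.
Proof. by rewrite -[RHS](perm_big _ disk2_opp) big_map. Qed.

Lemma sum_const_seq (T : Type) (s : seq T) (P : pred T) (a : Z) :
  \sum_(x <- s | P x) a = Z.of_nat (count P s) * a.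
Proof.
elim: s => [|x s IHs]; first by rewrite big_nil.
rewrite big_cons IHs [count P (x :: s)]/=; case: (P x); nia.
Qed.

Lemma psi_bounds n : -8 <= psi n <= 1.
Proof. by rewrite /psi; do 4![case: n => [|n] //]; rewrite /= nth_nil. Qed.

Lemma deg_rate_le d : (d <= 13)%N -> Z.of_nat d * rate d <= 840%coqZ.
Proof. by rewrite /rate; do 14![case: d => [|d] //]. Qed.

Lemma sum_disk2_le (h : cell -> Z) (a : Z) :
  (forall d, h d <= a) -> \sum_(d <- disk2) h d <= 13%coqZ * a.
Proof.
move=> ha; have -> : 13%coqZ * a = \sum_(d <- disk2) a by rewrite sum_const_seq.
exact: ler_sum.
Qed.

Lemma charge_le f x : charge f x <= 31%coqZ.
Proof.
have : \sum_(d <- disk2) psi (card f (x + d)) <= 13%coqZ * 1.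
  by apply: sum_disk2_le => d; case/andP: (psi_bounds (card f (x + d))).
by rewrite /charge; move: (\sum_(d <- disk2) _) => s; lia.
Qed.

(** 31 * 840, a uniform bound as [mass_transport] asks for. *)
Lemma gift_le f x : gift f x <= 26040%coqZ.
Proof.
rewrite /gift; case: ifP => // /negbT; rewrite -ltNge => c0.
have r840 : rate (deg f x) <= 840%coqZ := @rate_le 0 (deg f x) isT.
move: c0 (charge_le f x) r840 (rate_gt0 (deg f x)).
by move: (charge f x) (rate _) => q r; nia.
Qed.

Section Totals.

Variable f : pred cell.

Let only (p : cell) (a : Z) : Z := if f p then a else 0.

(** What [c] keeps after receiving its income and paying one gift for each vertex counted by [deg],
    in units of 1/840. *)
Let balance (c : cell) : Z :=
  (840%coqZ * charge f c + income f c - Z.of_nat (deg f c) * gift f c)%R.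

(** Without positive charge nothing is paid and [charge_income] applies; otherwise the payments are
    at most 840 times the charge by [deg_rate_le]. *)
Lemma balance_ge0 c :
  f c -> (forall x, f x -> separated f x) -> 0 <= balance c.
Proof.
move=> fc sep; have := charge_income fc sep.
have : 0 <= income f c.
  by apply: sumr_ge0 => d _; apply: sumr_ge0 => e _; apply: gift_ge0.
have hd : (deg f c <= 13)%N by apply: leq_trans (count_size _ _) _.
rewrite /balance /gift; move: (income f c) (deg_rate_le hd) => w.
case: ifP => [|/negbT]; first by rewrite mulr0 subr0.
rewrite -ltNge; move: (charge f c) (rate _) (Z.of_nat _) => q r k; nia.
Qed.

(** For [i = (d, e)], the gift that [y] pays to [y - (d + e)] across the vertex [y - e]. *)
Let sent (i : cell * cell) (y : cell) : Z :=
  if [&& f y, f (y - (i.1 + i.2)), card f (y - i.2) == 2 & i.1 + i.2 != 0]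
  then gift f y else 0.

Let steps : seq (cell * cell) := [seq (d, e) | d <- disk2, e <- disk2].

Lemma received_income c :
  \sum_(i <- steps) sent i (c + (i.1 + i.2)) = only c (income f c).
Proof.
rewrite big_allpairs /only /income; case fc: (f c); last first.
  apply: big1 => d _; apply: big1 => e _.
  by rewrite /sent /= addrK fc andbF.
rewrite [RHS]big_mkcond; apply: eq_bigr => d _; case: ifP => hd; last first.
  by apply: big1 => e _; rewrite /sent /= addrA addrK hd !andbF.
rewrite [RHS]big_mkcond; apply: eq_bigr => e _.
by rewrite /sent /= addrK fc addrA addrK hd.
Qed.

Lemma sent_gift y :
  \sum_(i <- steps) sent i y = only y (Z.of_nat (deg f y) * gift f y)%R.
Proof.
rewrite big_allpairs exchange_big /= /only; case fy: (f y); last first.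
  by apply: big1 => d _; apply: big1 => e _; rewrite /sent fy.
rewrite -sum_disk2_opp /deg -sum_const_seq [RHS]big_mkcond big_seq [RHS]big_seq.
apply: eq_bigr => e he; rewrite -sum_disk2_opp; case: ifP => hc; last first.
  by apply: big1 => d _; rewrite /sent /= opprK hc !andbF.
have eP d : (f (y - (- d - e)) && (- d - e != 0)) = f (y + e + d) && (d != - e).
  rewrite opprB opprK addrA; congr (_ && ~~ _).
  by rewrite subr_eq0 eqr_oppLR.
rewrite (eq_bigr (fun d => if f (y + e + d) && (d != - e) then gift f y else 0)).
  rewrite -big_mkcond sum_const_seq.
  (* I(y + e) has two codewords, and [d = - e] gives [y] itself; one receiver remains. *)
  suff -> : count (fun d => f (y + e + d) && (d != - e)) disk2 = 1%N by rewrite mul1r.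
  have := count_predC (pred1 (- e)) [seq d <- disk2 | f (y + e + d)].
  rewrite size_filter !count_filter.
  rewrite (_ : count (fun d => f (y + e + d)) disk2 = 2); last first.
    by move/eqP: hc; rewrite /card /ball2 count_map.
  rewrite (@eq_count _ _ (pred1 (- e))) => [|d /=]; last first.
    by case: eqP => // ->; rewrite addrK fy.
  rewrite count_uniq_mem ?disk2_uniq // -(perm_mem disk2_opp) map_f // => h.
  transitivity (count (predI (predC (pred1 (- e))) (fun d => f (y + e + d))) disk2).
    by apply: eq_count => d /=; rewrite andbC.
  by move: h; move: (count _ _) => k; lia.
by move=> d _; rewrite /sent fy /= opprK hc -eP.
Qed.

Let weight (n : nat) : Z := box_sum n (fun p => only p 1).

(** Summed over the box, gifts received exceed gifts paid by a boundary term at most, and only the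
    charges remain. *)
Lemma box_charge_ge : (forall x, f x -> separated f x) ->
  exists K : Z, forall n,
    0 <= 840%coqZ * box_sum n (fun p => only p (charge f p)) + K * side n.
Proof.
move=> sep; have sM i p : 0 <= sent i p <= 26040%coqZ.
  by rewrite /sent; case: ifP => // _; rewrite gift_ge0 gift_le.
have [K hK] := mass_transport steps (fun i => i.1 + i.2) sM.
exists K => n; have := hK n.
rewrite (eq_box_sum _ received_income) (eq_box_sum _ sent_gift).
have : 0 <= box_sum n (fun p => only p (balance p)).
  apply: sumr_ge0 => i _; apply: sumr_ge0 => j _; rewrite /only.
  by case: ifP => // fp; apply: balance_ge0.
have -> : box_sum n (fun p => only p (balance p)) =
    840%coqZ * box_sum n (fun p => only p (charge f p)) +
    box_sum n (fun p => only p (income f p)) +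
    -1 * box_sum n (fun p => only p (Z.of_nat (deg f p) * gift f p)%R).
  rewrite -!box_sumZ -!box_sumD; apply: eq_box_sum => p; rewrite /only /balance.
  by case: ifP; rewrite ?mulr0 ?addr0 // mulN1r.
move: (box_sum _ _) (box_sum _ _) (box_sum _ _) (K * _) => a b c d; lia.
Qed.

Lemma box_charge_le : (forall u, (0 < card f u)%N) ->
  exists K : Z, forall n, box_sum n (fun p => only p (charge f p)) <=
    70%coqZ * weight n - 12%coqZ * (side n * side n) + K * side n.
Proof.
move=> f_cover.
(* The shift by 8 makes the terms nonnegative, as [mass_transport] requires. *)
pose h d u : Z := if f (u - d) then (psi (card f u) + 8%coqZ)%R else 0.
have hM d u : 0 <= h d u <= 9%coqZ.
  by rewrite /h; case: ifP => // _; have := psi_bounds (card f u); lia.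
have [K hK] := mass_transport disk2 id hM.
have oM (d : cell) p : 0 <= only p 1 <= 1 by rewrite /only; case: ifP.
have [L hL] := mass_transport disk2 id oM.
exists (K + 12%coqZ * L) => n; have := hL n; have := hK n.
(* 86 = 13 * 8 - 18. *)
have -> : box_sum n (fun p => \sum_(d <- disk2) h d (p + d)) =
    box_sum n (fun p => only p (charge f p)) + 86%coqZ * weight n.
  rewrite -box_sumZ -box_sumD; apply: eq_box_sum => p; rewrite /only.
  under eq_bigr do rewrite /h addrK.
  case: ifP => fp; last by rewrite big1 // mulr0 addr0.
  rewrite big_split /= sum_const_seq /charge.
  by move: (\sum_(d <- disk2) _) => s; rewrite mulr1 [Z.of_nat _]/=; lia.
have -> : box_sum n (fun p => \sum_(d <- disk2) only (p + d) 1) =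
    box_sum n (fun p => Z.of_nat (card f p)).
  apply: eq_box_sum => p; rewrite -big_mkcond sum_const_seq mulr1.
  by rewrite /card count_map.
have -> : box_sum n (fun p => \sum_(d <- disk2) only p 1) = 13%coqZ * weight n.
  by rewrite -box_sumZ; apply: eq_box_sum => p; rewrite sum_const_seq.
have : box_sum n (fun p => \sum_(d <- disk2) h d p) <=
    12%coqZ * box_sum n (fun p => Z.of_nat (card f p)) + -12%coqZ * (side n * side n).
  rewrite mulrC -mulrC [-12%coqZ * _]mulrC -box_sum_const -box_sumZ -box_sumD.
  apply: box_sum_le => u.
  have -> : \sum_(d <- disk2) h d u = Z.of_nat (card f u) * (psi (card f u) + 8%coqZ).
    rewrite -sum_disk2_opp /h.
    under eq_bigr do rewrite opprK.
    by rewrite -big_mkcond sum_const_seq /card count_map.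
  (* For k = |I(u)| >= 1 the claim is k * (psi k + 8) <= 12 k - 12, an equality for k <= 4. *)
  move: (f_cover u); case: (card f u) => [|[|[|[|k]]]] // _.
  rewrite /psi /= nth_nil; lia.
(* The coefficient 70 is 12 * 13 - 86. *)
rewrite mulrDl -mulrA.
move: (weight n) (box_sum _ _) (box_sum _ _) (box_sum _ _) (K * _) (L * _) (side n * side n).
move=> a b c d e g i; lia.
Qed.

Theorem box_weight_ge : (forall x, f x -> separated f x) ->
  (forall u, (0 < card f u)%N) ->
  exists K : Z, forall n, 6%coqZ * (side n * side n) <= 35%coqZ * weight n + K * side n.
Proof.
move=> sep f_cover; have [K hK] := box_charge_ge sep; have [L hL] := box_charge_le f_cover.
(* Dividing by 840 and halving only shrink the error terms, so absolute values suffice. *)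
exists (Z.abs K + Z.abs L) => n; move: (hK n) (hL n).
have : 0 <= side n by rewrite /side; lia.
move: (box_sum _ _) (weight n) (side n) => a b c; nia.
Qed.

End Totals.

(** * From the grid graph to integer cells *)

Definition to_vertex (p : cell) : vertex := (int_of_Z p.1, int_of_Z p.2).

Definition of_vertex (v : vertex) : cell := (Z_of_int v.1, Z_of_int v.2).

Lemma of_vertexK : cancel of_vertex to_vertex.
Proof. by case=> a b; rewrite /of_vertex /to_vertex /= !Z_of_intK. Qed.

Lemma to_vertexK : cancel to_vertex of_vertex.
Proof. by case=> a b; rewrite /of_vertex /to_vertex /= !int_of_ZK. Qed.

Lemma to_vertexB p q : to_vertex (p - q) = to_vertex p - to_vertex q.
Proof. by case: p q => [a b] [c d]; rewrite /to_vertex /= !raddfB. Qed.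

Definition unit_steps : seq vertex := [:: (0, 1); (0, -1); (1, 0); (-1, 0)].

Lemma grid_edgeE u v : grid_edge u v = (v - u \in unit_steps).
Proof.
rewrite /grid_edge -[u - v]opprB; move: (v - u) => [a b].
by rewrite /unit_steps !inE !xpair_eqE /=; apply/idP/idP; lia.
Qed.

Lemma gdist_le u v k : has_walk u v k -> (gdist u v <= k)%N.
Proof.
by move=> h; rewrite /gdist; case: ex_minnP => m _; apply; apply/asboolP.
Qed.

(** Walks of at most two edges realise the sums of at most two unit steps; the comparison with
    [disk2] is computed. *)
Lemma gball2E u v : gball 2 u v <-> v - u \in [seq to_vertex d | d <- disk2].
Proof.
have step1 : all (fun e => e \in [seq to_vertex d | d <- disk2]) unit_steps.
  by vm_compute.
have step2 : all (fun e => all (fun e' => e + e' \in [seq to_vertex d | d <- disk2])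
    unit_steps) unit_steps by vm_compute.
have split2 : all (fun d => [|| d == 0, d \in unit_steps |
    has (fun e => d - e \in unit_steps) unit_steps]) [seq to_vertex d | d <- disk2].
  by vm_compute.
split=> [|/(allP split2)].
  rewrite /gball /= /gdist; case: ex_minnP => k /asboolP[p [hp <- <-]] _.
  case: p hp => [|a [|b [|]]] //= + _; rewrite ?grid_edgeE.
  - by move=> _; rewrite subrr; vm_compute.
  - by rewrite andbT => ha; apply: (allP step1).
  case/and3P=> ha hb _; rewrite -[b](subrK a) -addrA.
  by have /allP := allP step2 _ hb; apply.
case/or3P=> [|h|/hasP[e he h]].
- rewrite subr_eq0 => /eqP ->; apply: (@leq_trans 0) => //.
  by apply: gdist_le; exists [::].
- by apply: (@leq_trans 1) => //; apply: gdist_le; exists [:: v]; rewrite /= grid_edgeE h.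
apply: gdist_le; exists [:: u + e; v]; split=> //=.
rewrite !grid_edgeE andbT addrAC subrr add0r he /=.
by rewrite opprD addrA.
Qed.

Lemma gball2_ball u z : gball 2 (to_vertex u) (to_vertex z) <-> z \in ball2 u.
Proof.
rewrite gball2E -to_vertexB mem_map; last exact: can_inj to_vertexK.
rewrite /ball2; split=> [h|/mapP[d hd ->]]; last by rewrite addrAC subrr add0r.
by apply/mapP; exists (z - u); rewrite // addrC subrK.
Qed.

Definition codewords (C : set vertex) : pred cell := fun p => `[< C (to_vertex p) >].

(** Two distinct vertices that no codeword separates would have equal sets [Iset 2 C]. *)
Lemma identifying_separated C x :
  identifying 2 C -> separated (codewords C) x.
Proof.
move=> [_ _ ident] d e hd he ne; apply: contrapT => hn.
have hin : to_vertex (x + d) <> to_vertex (x + e).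
  by move=> /(can_inj to_vertexK)/addrI; apply/eqP.
apply: (ident _ _ hin); apply/seteqP; split=> v [hv Cv]; split=> //;
  move: hv; rewrite -[v]of_vertexK !gball2_ball => hv; apply: contrapT => hv';
  apply: hn; exists (of_vertex v); rewrite /codewords ?of_vertexK ?hv; try exact/asboolP;
  by case: (_ \in _) hv'.
Qed.

Lemma identifying_covered C u :
  identifying 2 C -> (0 < card (codewords C) u)%N.
Proof.
move=> [_ /(_ (to_vertex u))[v [hv Cv]] _]; rewrite /card -has_count.
apply/hasP; exists (of_vertex v); first by apply/gball2_ball; rewrite of_vertexK.
by rewrite /codewords of_vertexK; apply/asboolP.
Qed.

Definition box_cells (n : nat) : seq cell :=
  [seq (axis n i, axis n j) | i <- iota 0 n.*2.+1, j <- iota 0 n.*2.+1].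

Lemma box_cells_uniq n : uniq (box_cells n).
Proof.
have axisI : injective (axis n) by move=> i j; rewrite /axis; lia.
apply: allpairs_uniq => [||[i j] [k l] _ _ /= [/axisI -> /axisI ->] //]; exact: iota_uniq.
Qed.

Lemma mem_box_cells n v : (of_vertex v \in box_cells n) <-> box n v.
Proof.
have ax (a : int) : reflect (exists2 i, i \in iota 0 n.*2.+1 & Z_of_int a = axis n i)
    (`|a| <= n%:Z).
  apply: (iffP idP) => [h|[i]]; last by rewrite mem_iota /axis => h1 h2; lia.
  by exists (absz (a + n%:Z)); rewrite ?mem_iota /axis; lia.
case: v => a b; split=> [/allpairsP[[i j] /= [hi hj [ha hb]]]|[/= /ax[i hi ha] /ax[j hj hb]]].
  by split=> /=; apply/ax; [exists i|exists j].
by apply/allpairsP; exists (i, j); split=> //=; rewrite /of_vertex /= ha hb.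
Qed.

Lemma card_box_codewords (C : set vertex) n :
  #|` fset_set (C `&` box n)| = count (codewords C) (box_cells n).
Proof.
rewrite -size_filter -(size_map to_vertex).
have U : uniq [seq to_vertex p | p <- box_cells n & codewords C p].
  rewrite map_inj_uniq; last exact: can_inj to_vertexK.
  by rewrite filter_uniq // box_cells_uniq.
rewrite -[RHS](congr1 size (undup_id U)) -card_fseq; congr #|` _|.
have fin : finite_set (C `&` box n).
  by apply: sub_finite_set (@finite_box n) => v [].
apply/fsetP => v; rewrite in_fset_set // !inE.
apply/idP/mapP => [|[p + ->]].
  rewrite inE => -[Cv /mem_box_cells hv]; exists (of_vertex v); last by rewrite of_vertexK.
  by rewrite mem_filter hv andbT /codewords of_vertexK; apply/asboolP.
rewrite mem_filter => /andP[/asboolP Cp hp]; rewrite inE; split=> //.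
by apply/mem_box_cells; rewrite to_vertexK.
Qed.

Lemma box_weightE (f : pred cell) n :
  box_sum n (fun p => if f p then 1 else 0) = Z.of_nat (count f (box_cells n)).
Proof.
rewrite -[RHS]mulr1 -sum_const_seq big_mkcond /box_cells big_allpairs_dep.
by rewrite /box_sum /index_iota subn0.
Qed.

(** * Passage to the density *)

Lemma limn_esup_ge (R : realType) (u : nat -> \bar R) (l K : R) :
  (forall n, (l - K / n.+1%:R)%:E <= u n)%E -> (l%:E <= limn_esup u)%E.
Proof.
move=> hu; rewrite limn_esup_lim; apply: lime_ge; first exact: is_cvg_esups.
apply: nearW => n; apply/lee_subgt0Pr => e e0.
(* At this index [K / m.+1] is at most [e], and [m >= n] puts [u m] into the tail. *)
pose m := maxn n (Num.truncn (`|K| / e)).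
apply: (@le_trans _ _ (u m)); last first.
  by apply: ereal_sup_ubound; exists m => //=; rewrite leq_maxl.
apply: le_trans (hu m); rewrite -EFinB lee_fin lerD2l lerN2.
rewrite ler_pdivrMr ?ltr0n //; apply: le_trans (ler_norm K) _.
rewrite mulrC -ler_pdivrMr //; apply/ltW/(lt_le_trans (truncnS_gt _)).
by rewrite ler_nat ltnS leq_maxr.
Qed.

Theorem theorem3p5 (R : realType) (C : set vertex) (hC : identifying 2 C) :
  ((6 / 35)%:E <= density R C)%E.
Proof.
have [K hK] := box_weight_ge (fun x _ => identifying_separated x hC)
  (fun u => identifying_covered u hC).
(* With N = 2 n + 1 the error is at most k * N / N ^ 2, where k = |K|, and N >= n + 1 bounds it by k
   / (n + 1). *)
apply: (@limn_esup_ge _ _ _ (`|int_of_Z K|%N%:R)) => n.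
have -> : #|` fset_set (box n)| = (n.*2.+1 * n.*2.+1)%N.
  (* The box is counted as the part in it of the code of all vertices. *)
  by rewrite -[box n]setTI card_box_codewords (@eq_count _ _ predT) => [|p];
    [rewrite count_predT size_allpairs size_iota|rewrite /codewords asboolT].
rewrite card_box_codewords lee_fin.
have := hK n; rewrite box_weightE /side; move: (count _ _) => a hn.
have {}hn : (6 * (n.*2.+1 * n.*2.+1) <= 35 * a + `|int_of_Z K| * n.*2.+1)%N by nia.
move: (`|int_of_Z K|%N) hn => k; rewrite -(ler_nat R) !natrD !natrM.
set N := (n.*2.+1%:R : R) => hn.
have N0 : 0 < N by rewrite ltr0n.
have M0 : 0 < n.+1%:R :> R by rewrite ltr0n.
have MN : n.+1%:R <= N by rewrite ler_nat ltnS -addnn leq_addr.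
have k0 : 0 <= k%:R :> R by [].
have q0 : 0 <= k%:R / n.+1%:R :> R by rewrite divr_ge0.
have qM : k%:R <= k%:R / n.+1%:R * N by rewrite mulrAC ler_pdivlMr // ler_wpM2l.
rewrite ler_pdivlMr ?mulr_gt0 //.
move: (k%:R / n.+1%:R) q0 qM => q q0 qM.
have : k%:R * N <= q * (N * N) by rewrite mulrA ler_wpM2r // ltW.
have : 0 <= k%:R * N by rewrite mulr_ge0 // ltW.
rewrite mulrBl; move: (N * N) (k%:R * N) (q * _) hn => N2 x y; lra.
Qed.
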